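(* Let $k$ be a field and $G$ a finite group. Let $X$ be a set of representatives of the conjugacy classes of $G$. Compute $HH^*(kG)$ by the normalized cochain complex $\mathrm{Map}(\overline{G}^{\times *},kG)$ and, for $x\in X$, compute $H^*(C_G(x),k)$ by the normalized cochain complex $\mathrm{Map}(\overline{C_G(x)}^{\times *},k)$. Then an isomorphism of graded vector spaces (the additive decomposition) $$HH^*(kG)\xrightarrow{\ \sim\ }\bigoplus_{x\in X}H^*(C_G(x),k)$$ is realized as follows: the class $[\varphi]$ of a cocycle $\varphi:\overline{G}^{\times n}\to kG$ is sent to $\bigoplus_{x\in X}[\widehat\varphi_x]$, where $\widehat\varphi_x:\overline{C_G(x)}^{\times n}\to k$ is defined by letting $\widehat\varphi_x(h_1,\dots,h_n)$ be the coefficient of $x$ in $$(-1)^{\frac{n(n+1)}{2}}\,h_1\cdots h_n\,\varphi(h_n^{-1},\dots,h_1^{-1})\in kG .$$ The inverse isomorphism sends $\bigoplus_{x\in X}[\widehat\varphi_x]$, with cocycles $\widehat\varphi_x:\overline{C_G(x)}^{\times n}\to k$, to the class of $\varphi:\overline{G}^{\times n}\to kG$ given by $$\varphi(g_1,\dots,g_n)=(-1)^{\frac{n(n+1)}{2}}\,g_1\cdots g_n\sum_{x\in X}\sum_{i=1}^{n_x}\widehat\varphi_x(h'_{i,1},\dots,h'_{i,n})\,x_i ,$$ where for $x\in X$ and $1\le i\le n_x$ the elements $h'_{i,1},\dots,h'_{i,n}\in C_G(x)$ (depending on $x$) are determined by the sequence $g_n^{-1},\dots,g_1^{-1}$ through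 $$\gamma_{i,x}g_n^{-1}=h'_{i,1}\gamma_{s_i^1,x},\quad \gamma_{s_i^1,x}g_{n-1}^{-1}=h'_{i,2}\gamma_{s_i^2,x},\quad\dots,\quad \gamma_{s_i^{n-1},x}g_1^{-1}=h'_{i,n}\gamma_{s_i^n,x}.$$
   Context: For a group $H$ write $\overline{H}=H\setminus\{1\}$. For a $k$-vector space $V$, $\mathrm{Map}(\overline{H}^{\times n},V)$ denotes all maps of sets, identified with $\mathrm{Hom}_k((kH/k\cdot 1)^{\otimes n},V)$ (and with $V$ for $n=0$); accordingly, in every formula such a map takes the value $0$ whenever one of its arguments equals $1$. Hochschild cohomology: $HH^*(kG)$ is the cohomology of $C^n(kG)=\mathrm{Map}(\overline{G}^{\times n},kG)$ with differential $\delta_0(a)(g)=ga-ag$ and $$\delta_n(\varphi)(g_1,\dots,g_{n+1})=g_1\varphi(g_2,\dots,g_{n+1})+\sum_{i=1}^n(-1)^i\varphi(g_1,\dots,g_ig_{i+1},\dots,g_{n+1})+(-1)^{n+1}\varphi(g_1,\dots,g_n)g_{n+1}.$$ Group cohomology: for a finite group $H$, $H^*(H,k)$ (trivial coefficients) is the cohomology of $\mathrm{Map}(\overline{H}^{\times n},k)$ with $$\delta_n(\psi)(h_1,\dots,h_{n+1})=\psi(h_2,\dots,h_{n+1})+\sum_{i=1}^n(-1)^i\psi(h_1,\dots,h_ih_{i+1},\dots,h_{n+1})+(-1)^{n+1}\psi(h_1,\dots,h_n).$$ For $x\in X$: $C_x$ is the conjugacy class of $x$, $C_G(x)$ the centralizer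 of $x$, $n_x=|C_x|=[G:C_G(x)]$; fix right coset representatives $\gamma_{1,x}=1,\gamma_{2,x},\dots,\gamma_{n_x,x}$, so that $G=\bigsqcup_{i=1}^{n_x}C_G(x)\gamma_{i,x}$, and put $x_i=\gamma_{i,x}^{-1}x\gamma_{i,x}$, so $C_x=\{x_1=x,x_2,\dots,x_{n_x}\}$. Since the cosets are disjoint, for $g\in G$ and $1\le i\le n_x$ the equation $\gamma_{i,x}g=h\gamma_{s,x}$ determines $h\in C_G(x)$ and the index $s$ uniquely. *)

(* Defs.v *)
From HB Require Import structures.
From mathcomp Require Import all_boot all_order all_algebra all_fingroup all_field.

Set Implicit Arguments.
Unset Strict Implicit.
Unset Printing Implicit Defensive.

Import GRing.Theory.
Local Open Scope ring_scope.
Local Open Scope quotient_scope.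

Section QuotientSpace.
Variables (k : fieldType) (V : vectType k) (U : {vspace V}).

Definition vquot : Type := {ideal_quot (pred_of_vspace U)}.

HB.instance Definition _ := ZmodQuotient.on vquot.

Definition vquot_scale (a : k) (u : vquot) : vquot :=
  \pi_vquot (a *: generic_quotient.repr u).

Lemma pi_vquotP (u v : V) :
  reflect (\pi_vquot u = \pi_vquot v) (u - v \in U).
Proof. by rewrite (Quotient.idealrBE (pred_of_vspace U)); apply: eqP. Qed.

Lemma vquot_scaleE a v :
  vquot_scale a (\pi_vquot v) = \pi_vquot (a *: v).
Proof.
apply/pi_vquotP; rewrite -scalerBr memvZ //.
by apply/pi_vquotP; rewrite generic_quotient.reprK.
Qed.

Lemma vquot_scaleA a b v :
  vquot_scale a (vquot_scale b v) = vquot_scale (a * b) v.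
Proof.
by rewrite -[v]generic_quotient.reprK (vquot_scaleE b) !vquot_scaleE scalerA.
Qed.
Lemma vquot_scale1 : left_id 1 vquot_scale.
Proof. by move=> v; rewrite -[v]generic_quotient.reprK vquot_scaleE scale1r. Qed.
Lemma vquot_scaleDr : right_distributive vquot_scale +%R.
Proof.
move=> a u v; rewrite -[u]generic_quotient.reprK -[v]generic_quotient.reprK.
by rewrite -[in LHS]raddfD !vquot_scaleE scalerDr raddfD.
Qed.
Lemma vquot_scaleDl v : {morph vquot_scale^~ v : a b / a + b}.
Proof.
by move=> a b; rewrite -[v]generic_quotient.reprK !vquot_scaleE scalerDl raddfD.
Qed.

HB.instance Definition _ := GRing.Zmodule_isLmodule.Build k vquot
  vquot_scaleA vquot_scale1 vquot_scaleDr vquot_scaleDl.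

End QuotientSpace.

(* The index type is finite, so the direct sum is the full product. *)
Section DirectSum.
Variables (k : fieldType) (I : finType) (V : I -> lmodType k).

Definition dirsum : Type := {dffun forall i : I, V i}.
HB.instance Definition _ := Choice.on dirsum.

Definition dirsum_zero : dirsum := [ffun i => 0].
Definition dirsum_opp (u : dirsum) : dirsum := [ffun i => - u i].
Definition dirsum_add (u v : dirsum) : dirsum := [ffun i => u i + v i].
Definition dirsum_scale (a : k) (u : dirsum) : dirsum := [ffun i => a *: u i].

Lemma dirsum_addA : associative dirsum_add.
Proof. by move=> u v w; apply/ffunP=> i; rewrite !ffunE addrA. Qed.
Lemma dirsum_addC : commutative dirsum_add.
Proof. by move=> u v; apply/ffunP=> i; rewrite !ffunE addrC. Qed.
Lemma dirsum_add0 : left_id dirsum_zero dirsum_add.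
Proof. by move=> u; apply/ffunP=> i; rewrite !ffunE add0r. Qed.
Lemma dirsum_addN : left_inverse dirsum_zero dirsum_opp dirsum_add.
Proof. by move=> u; apply/ffunP=> i; rewrite !ffunE addNr. Qed.

HB.instance Definition _ := GRing.isZmodule.Build dirsum
  dirsum_addA dirsum_addC dirsum_add0 dirsum_addN.

Lemma dirsum_scaleA a b u :
  dirsum_scale a (dirsum_scale b u) = dirsum_scale (a * b) u.
Proof. by apply/ffunP=> i; rewrite !ffunE scalerA. Qed.
Lemma dirsum_scale1 : left_id 1 dirsum_scale.
Proof. by move=> u; apply/ffunP=> i; rewrite !ffunE scale1r. Qed.
Lemma dirsum_scaleDr : right_distributive dirsum_scale +%R.
Proof. by move=> a u v; apply/ffunP=> i; rewrite !ffunE scalerDr. Qed.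
Lemma dirsum_scaleDl u : {morph dirsum_scale^~ u : a b / a + b}.
Proof. by move=> a b; apply/ffunP=> i; rewrite !ffunE scalerDl. Qed.

HB.instance Definition _ := GRing.Zmodule_isLmodule.Build k dirsum
  dirsum_scaleA dirsum_scale1 dirsum_scaleDr dirsum_scaleDl.

End DirectSum.

(* A fresh type, because {ffun G -> k} carries the pointwise product. *)
Section GroupAlgebra.
Variables (k : fieldType) (G : finGroupType).

Definition group_algebra : Type := {ffun G -> k}.
HB.instance Definition _ := Vector.copy group_algebra {ffun G -> k^o}.

Definition gcoef (a : group_algebra) (g : G) : k := (a : {ffun G -> k}) g.
Definition gelt (g : G) : group_algebra := [ffun h => (h == g)%:R].
Definition gmul (a b : group_algebra) : group_algebra :=
  [ffun g => \sum_h gcoef a h * gcoef b (h^-1 * g)%g].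

Lemma gmulA : associative gmul.
Proof.
move=> a b c; apply/ffunP=> g; rewrite !ffunE /gcoef.
under eq_bigr do rewrite ffunE mulr_sumr.
under [RHS]eq_bigr do rewrite ffunE mulr_suml.
rewrite [RHS]exchange_big /=; apply: eq_bigr => h _.
rewrite [RHS](reindex_inj (mulgI h)) /=; apply: eq_bigr => u _.
by rewrite /gcoef mulKg invMg mulrA mulgA.
Qed.
Lemma gmul1l : left_id (gelt 1%g) gmul.
Proof.
move=> a; apply/ffunP=> g; rewrite ffunE (bigD1 1%g) //= big1 => [|h h1].
  by rewrite /gcoef ffunE eqxx mul1r invg1 mul1g addr0.
by rewrite /gcoef ffunE (negPf h1) mul0r.
Qed.
Lemma gmul1r : right_id (gelt 1%g) gmul.
Proof.
move=> a; apply/ffunP=> g; rewrite ffunE (bigD1 g) //= big1 => [|h hg].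
  by rewrite /gcoef ffunE mulVg eqxx mulr1 addr0.
by rewrite /gcoef ffunE -eq_mulVg1 (negPf hg) mulr0.
Qed.
Lemma gmulDl : left_distributive gmul +%R.
Proof.
move=> a b c; apply/ffunP=> g; rewrite !ffunE -big_split /=.
by apply: eq_bigr => h _; rewrite /gcoef ffunE mulrDl.
Qed.
Lemma gmulDr : right_distributive gmul +%R.
Proof.
move=> a b c; apply/ffunP=> g; rewrite !ffunE -big_split /=.
by apply: eq_bigr => h _; rewrite /gcoef ffunE mulrDr.
Qed.
Lemma gelt1_neq0 : gelt 1%g != 0.
Proof.
by apply/eqP=> /ffunP/(_ 1%g)/eqP; rewrite !ffunE eqxx oner_eq0.
Qed.

HB.instance Definition _ := GRing.Zmodule_isNzRing.Build group_algebra
  gmulA gmul1l gmul1r gmulDl gmulDr gelt1_neq0.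

Lemma gscaleAl (c : k) (a b : group_algebra) : c *: (a * b) = (c *: a) * b.
Proof.
apply/ffunP=> g; rewrite !ffunE scaler_sumr.
by apply: eq_bigr => h _; rewrite /gcoef ffunE; apply: mulrA.
Qed.
HB.instance Definition _ :=
  GRing.Lmodule_isLalgebra.Build k group_algebra gscaleAl.

Lemma gscaleAr (c : k) (a b : group_algebra) : c *: (a * b) = a * (c *: b).
Proof.
apply/ffunP=> g; rewrite !ffunE scaler_sumr.
by apply: eq_bigr => h _; rewrite /gcoef ffunE; apply: mulrCA.
Qed.
HB.instance Definition _ :=
  GRing.Lalgebra_isAlgebra.Build k group_algebra gscaleAr.
HB.instance Definition _ := Algebra_isFalgebra.Build k group_algebra.

Lemma geltM (g h : G) : gelt (g * h)%g = gelt g * gelt h :> group_algebra.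
Proof.
apply/ffunP=> u; rewrite !ffunE (bigD1 g) //= big1 => [|v vg].
  by rewrite /gcoef !ffunE eqxx mul1r addr0 -[in RHS](inj_eq (mulgI g)) mulKVg.
by rewrite /gcoef !ffunE (negPf vg) mul0r.
Qed.

End GroupAlgebra.

Arguments gelt k {G} g.

Definition nontriv (H : finGroupType) : Type := {h : H | h != 1%g}.
HB.instance Definition _ (H : finGroupType) := Finite.on (nontriv H).

Notation cochain H V n := {ffun n.-tuple (nontriv H) -> V}.

Section Cohomology.
Variables (k : fieldType) (H : finGroupType) (V : vectType k).

(* The value of a normalized cochain at an n-tuple of arbitrary elements of H,
   given as a sequence of size n: it is 0 when an argument is 1. *)
Definition ceval n (f : cochain H V n) (s : seq H) : V :=
  if [pick t : n.-tuple (nontriv H) | map val t == s] is Some t then f t else 0.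

Lemma ceval_val n (f : cochain H V n) (t : n.-tuple (nontriv H)) :
  ceval f (map val t) = f t.
Proof.
rewrite /ceval; case: pickP => [u /eqP|/(_ t)]; last by rewrite eqxx.
by move/(inj_map val_inj)/val_inj ->.
Qed.

Lemma ceval1 n (f : cochain H V n) (s : seq H) : 1%g \in s -> ceval f s = 0.
Proof.
rewrite /ceval; case: pickP => // t /eqP <- /mapP[h _ h1].
by have := valP h; rewrite -h1 eqxx.
Qed.

Lemma ceval_is_linear n s : linear (fun f : cochain H V n => ceval f s).
Proof.
move=> a f g; rewrite /ceval; case: pickP => [t _|_]; first by rewrite !ffunE.
by rewrite scaler0 addr0.
Qed.

(* (g_1, ..., g_m) |-> (g_1, ..., g_j g_(j+1), ..., g_m) with j = i + 1. *)
Definition merge_at (s : seq H) (i : nat) : seq H :=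
  take i s ++ (nth 1 s i * nth 1 s i.+1)%g :: drop i.+2 s.

(* The left and right actions of H on the coefficients. *)
Variables l r : H -> 'End(V).

Definition codiff_fun n (f : cochain H V n) : cochain H V n.+1 :=
  [ffun t : n.+1.-tuple (nontriv H) => let s := map val t in
     l (head 1%g s) (ceval f (behead s))
     + \sum_(i < n) (-1) ^+ i.+1 *: ceval f (merge_at s i)
     + (-1) ^+ n.+1 *: r (last 1%g s) (ceval f (take n s))].

Lemma codiff_is_linear n : linear (@codiff_fun n).
Proof.
move=> a f g; apply/ffunP=> t; rewrite !ffunE /= !ceval_is_linear !linearP.
rewrite !scalerDr !scalerA [in RHS]addrACA; congr (_ + _).
rewrite [in RHS]addrACA; congr (_ + _).
rewrite scaler_sumr -big_split /=; apply: eq_bigr => i _.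
by rewrite ceval_is_linear scalerDr !scalerA mulrC.
Qed.

HB.instance Definition _ n :=
  GRing.isLinear.Build k (cochain H V n) (cochain H V n.+1) _
    (@codiff_fun n) (@codiff_is_linear n).

Definition codiff n : 'Hom(cochain H V n, cochain H V n.+1) :=
  linfun (@codiff_fun n).

Lemma codiffE n (f : cochain H V n) : codiff n f = codiff_fun f.
Proof. by rewrite lfunE. Qed.

Definition cocycles n : {vspace cochain H V n} := lker (codiff n).

Definition coboundaries n : {vspace cochain H V n} :=
  if n is m.+1 then limg (codiff m) else 0%VS.

Definition cohomology n : lmodType k :=
  vquot (linfun (@vsval _ _ (cocycles n)) @^-1: coboundaries n)%VS.

(* Only meaningful for f \in cocycles n, on which vsproj is the identity. *)
Definition coh_class n (f : cochain H V n) : cohomology n :=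
  \pi_(vquot _) (vsproj (cocycles n) f).

Lemma coh_classP n (f g : cochain H V n) :
    f \in cocycles n -> g \in cocycles n ->
  reflect (coh_class f = coh_class g) (f - g \in coboundaries n).
Proof.
move=> Zf Zg; suff ->: (f - g \in coboundaries n) =
    (vsproj (cocycles n) f - vsproj (cocycles n) g \in
       linfun (@vsval _ _ (cocycles n)) @^-1: coboundaries n)%VS.
  exact: pi_vquotP.
by rewrite -memv_preim linearB /= !lfunE /= !vsprojK.
Qed.

End Cohomology.

Section Instances.
Variables (k : fieldType) (H : finGroupType).

Definition HH_left (g : H) : 'End(group_algebra k H) := amull (gelt k g).
Definition HH_right (g : H) : 'End(group_algebra k H) := amulr (gelt k g).

Definition trivial_act (h : H) : 'End(k^o) := \1%VF.

End Instances.

Notation HH k G n := (cohomology (@HH_left k G) (@HH_right k G) n).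
Notation HH_cocycles k G n := (cocycles (@HH_left k G) (@HH_right k G) n).
Notation HH_class f := (coh_class (@HH_left _ _) (@HH_right _ _) f).

Notation GH k H n := (cohomology (@trivial_act k H) (@trivial_act k H) n).
Notation GH_cocycles k H n := (cocycles (@trivial_act k H) (@trivial_act k H) n).
Notation GH_class f := (coh_class (@trivial_act _ _) (@trivial_act _ _) f).

Notation Cent x := (subg_of 'C[x]%G).

Definition class_size (G : finGroupType) (x : G) : nat := #|(x ^: [set: G])%g|.

Section Formulas.
Variables (k : fieldType) (G : finGroupType).

Definition inv_sign n : k := (-1) ^+ (n * n.+1)./2.

Definition hat n (phi : cochain G (group_algebra k G) n) (x : G) :
    cochain (Cent x) k^o n :=
  [ffun t : n.-tuple (nontriv (Cent x)) =>
     let h := [seq sgval (val u) | u <- t] in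
     gcoef (inv_sign n *:
       (gelt k (\prod_(g <- h) g)%g * ceval phi (rev [seq g^-1%g | g <- h]))) x].

Variable gamma : forall x : G, 'I_(class_size x) -> G.

(* Indices run over {0, ..., n_x - 1} instead of {1, ..., n_x}. *)
Definition coset_reps (x : G) : Prop :=
  (forall i : 'I_(class_size x), i = 0%N :> nat -> gamma i = 1%g) /\
  (forall g : G, exists! i : 'I_(class_size x), g \in 'C[x] :* gamma i)%g.

(* The pair (h, s) with gamma_i g = h gamma_s; under [coset_reps x] it exists
   and is unique (see coset_stepP), so the default value is never used. *)
Definition coset_step (x : G) (i : 'I_(class_size x)) (g : G) :
    Cent x * 'I_(class_size x) :=
  odflt (1%g, i) [pick p : Cent x * 'I_(class_size x) |
                  (gamma i * g)%g == (sgval p.1 * gamma p.2)%g].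

Lemma coset_stepP (x : G) (i : 'I_(class_size x)) (g : G) :
    coset_reps x ->
  forall (h : Cent x) (s : 'I_(class_size x)),
  (gamma i * g = sgval h * gamma s)%g <-> coset_step i g = (h, s).
Proof.
case=> _ repx h s.
have uniq (h1 h2 : Cent x) (s1 s2 : 'I_(class_size x)) :
    (sgval h1 * gamma s1 = sgval h2 * gamma s2)%g -> (h1, s1) = (h2, s2).
  move=> E; have [j [_ Uj]] := repx (sgval h1 * gamma s1)%g.
  have j1 := Uj s1; have j2 := Uj s2; have E12 : s1 = s2.
    rewrite -j1 ?mem_rcoset ?mulgK ?subgP // -j2 //.
    by rewrite E mem_rcoset mulgK subgP.
  by move: E; rewrite E12 => /mulIg/subg_inj ->.
rewrite /coset_step; case: pickP => [[h' s'] /= /eqP E | no].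
  split=> [E' | [<- <-] //]; apply: uniq; by rewrite -E.
have [j [Cj _]] := repx (gamma i * g)%g.
move: Cj; rewrite mem_rcoset => Cj.
by have := no (subg 'C[x] (gamma i * g * (gamma j)^-1)%g, j);
  rewrite /= subgK // mulgKV eqxx.
Qed.

Fixpoint coset_walk (x : G) (i : 'I_(class_size x)) (s : seq G) :
    seq (Cent x) :=
  if s is g :: s' then
    let p := coset_step i g in p.1 :: coset_walk p.2 s'
  else [::].

Definition unhat (X : {set G}) n
    (psi : forall x : {x : G | x \in X}, cochain (Cent (val x)) k^o n) :
    cochain G (group_algebra k G) n :=
  [ffun t : n.-tuple (nontriv G) =>
     let g := [seq val u | u <- t] in
     inv_sign n *: (gelt k (\prod_(u <- g) u)%g *
       \sum_(x : {x : G | x \in X}) \sum_(i < class_size (val x))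
         (ceval (psi x) (coset_walk i (rev [seq u^-1%g | u <- g])) : k)
           *: gelt k (val x ^ gamma i)%g)].

End Formulas.

(* Main.v *)
(** Set a(u_1,...,u_n; y) to be the coefficient of y in
    (-1)^(n(n+1)/2) u_1 ... u_n phi(u_n^-1,...,u_1^-1).  In terms of a, the
    Hochschild differential is the differential of normalized cochains on the
    action groupoid of G acting on itself by conjugation (arrows
    u : y -> y ^ u).  Restriction of a to the isotropy groups of the points of
    X is phi |-> hat phi, and pullback along the retraction of the groupoid
    onto these isotropy groups determined by the arrows
    gamma_i : x -> x ^ gamma_i is unhat.  Both are cochain maps,
    hat (unhat psi) = psi because gamma_1 = 1, and the arrows gamma_i form a
    natural isomorphism whose prism operator is a homotopy from unhat (hat phi)
    to phi. *)

From HB Require Import structures.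
Require Import Defs.
From mathcomp Require Import all_boot all_order all_algebra all_fingroup all_field.
From mathcomp Require Import ring.

Set Implicit Arguments.
Unset Strict Implicit.
Unset Printing Implicit Defensive.

Import GRing.Theory.
Local Open Scope ring_scope.

Local Notation HH_codiff k G n := (codiff (@HH_left k G) (@HH_right k G) n).
Local Notation HH_coboundaries k G n :=
  (coboundaries (@HH_left k G) (@HH_right k G) n).
Local Notation GH_codiff k H n :=
  (codiff (@trivial_act k H) (@trivial_act k H) n).
Local Notation GH_coboundaries k H n :=
  (coboundaries (@trivial_act k H) (@trivial_act k H) n).

(* The inner and last faces of a simplex of the bar construction, with
   alternating signs; on sequences that grow at the head this sum satisfies a
   two-term recursion. *)
Fixpoint faces (H : finGroupType) (V : zmodType) (F : seq H -> V) (s : seq H) :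
    V :=
  if s is u :: s' then
    if s' is v :: s'' then
      F ((u * v)%g :: s'') - faces (fun t => F (u :: t)) s'
    else F [::]
  else 0.

Arguments faces : simpl never.

(** * Face sums and normalization *)

Section Faces.
Variables (H : finGroupType) (V : zmodType).
Implicit Types (F : seq H -> V) (s t : seq H).

Lemma faces_cons F u v s :
  faces F (u :: v :: s)
    = F ((u * v)%g :: s) - faces (fun t => F (u :: t)) (v :: s).
Proof. by []. Qed.

Lemma eq_faces F F' s : F =1 F' -> faces F s = faces F' s.
Proof.
elim: s F F' => [|u [|v s] IHs] F F' eqF //; first exact: eqF.
by rewrite !faces_cons eqF; congr (_ - _); apply: IHs => t; apply: eqF.
Qed.

Lemma facesB F F' s : faces (fun t => F t - F' t) s = faces F s - faces F' s.
Proof.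
elim: s F F' => [|u [|v s] IHs] F F' //; first by rewrite /faces subr0.
rewrite !faces_cons (IHs (fun t => F (u :: t)) (fun t => F' (u :: t))).
by rewrite ![- (_ - _)]opprD !opprK addrACA.
Qed.

(** Merging the leading 1 with its neighbour, or dropping it when s is empty, gives F s; every other
    face still starts with 1 and is killed by normalization. *)
Lemma faces1 F s : (forall s, 1%g \in s -> F s = 0) -> faces F (1%g :: s) = F s.
Proof.
case: s => [|v s] F1 //; rewrite faces_cons mul1g.
suff -> : faces (fun t => F (1%g :: t)) (v :: s) = 0 by rewrite subr0.
rewrite (@eq_faces _ (fun=> 0 - 0)) ?facesB ?subrr // => t.
by rewrite F1 ?mem_head // subr0.
Qed.

(** An entry 1 of s has a left neighbour. The two faces that absorb it, to the left and to the right
    (or by dropping it at the end), coincide and carry opposite signs; the others still contain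
    1. *)
Lemma faces_norm F u s : (forall s, 1%g \in s -> F s = 0) ->
  1%g \in s -> faces F (u :: s) = 0.
Proof.
elim: s F u => // v s IHs F u F1; have F1u t : 1%g \in t -> F (u :: t) = 0.
  by move=> t1; rewrite F1 // inE t1 orbT.
rewrite inE faces_cons; have [<- _|_ /= s1] := eqVneq.
  by rewrite mulg1 faces1 ?subrr.
by rewrite F1 ?inE ?s1 ?orbT // (IHs (fun t => F (u :: t))) ?subr0.
Qed.

End Faces.

Lemma merge_at_cat (H : finGroupType) (s1 s2 : seq H) (a b : H) :
  merge_at (s1 ++ a :: b :: s2) (size s1) = s1 ++ (a * b)%g :: s2.
Proof.
rewrite /merge_at take_size_cat // nth_cat ltnn subnn /=.
rewrite nth_cat ltnNge leqnSn subSnn /=; congr (_ ++ _ :: _).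
by rewrite drop_cat ltnNge !leqW // -addn2 addKn /= drop0.
Qed.

(** Links the recursion to the explicit sum in [codiff_fun]. The signs start with + at i = 0, so
    this is minus the corresponding terms of the differential. *)
Lemma faces_sum (k : fieldType) (H : finGroupType) (V : lmodType k)
    (F : seq H -> V) n (s : seq H) : size s = n.+1 ->
  faces F s = \sum_(i < n) (-1) ^+ i *: F (merge_at s i)
              + (-1) ^+ n *: F (take n s).
Proof.
elim: n F s => [|n IHn] F [|u [|v s]] //= => [_|[sz]].
  by rewrite big_ord0 add0r scale1r.
rewrite faces_cons big_ord_recl /= scale1r /merge_at /= drop0 -addrA.
congr (_ + _); rewrite (IHn (fun t => F (u :: t)) (v :: s)) ?[size _]/= ?sz //.
rewrite opprD; congr (_ + _); last first.
  by rewrite exprS mulN1r scaleNr.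
rewrite -sumrN; apply: eq_bigr => i _.
by rewrite /= /bump exprS mulN1r scaleNr.
Qed.

Lemma faces_map (V : zmodType) (H K : finGroupType)
    (f : H -> K) (F : seq K -> V) (s : seq H) : {morph f : a b / (a * b)%g} ->
  faces (fun t => F (map f t)) s = faces F (map f s).
Proof.
move=> fM; elim: s F => [|u [|v s] IHs] F //.
by rewrite !faces_cons -fM -(IHs (fun t => F (f u :: t))).
Qed.

(** * Normalized cochains as functions on sequences *)

Section Ceval.
Variables (k : fieldType) (H : finGroupType) (V : vectType k).

Lemma nontriv_seqP n (s : seq H) : size s = n -> 1%g \notin s ->
  exists t : n.-tuple (nontriv H), s = map val t.
Proof.
elim: s n => [|u s IHs] [|n] //= => [_ _|[sz]]; first by exists [tuple].
rewrite inE negb_or eq_sym => /andP[u1 /(IHs _ sz)[t ->]].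
by exists [tuple of (Sub u u1 : nontriv H) :: t].
Qed.

Lemma ceval_size n (f : cochain H V n) s : size s != n -> ceval f s = 0.
Proof.
rewrite /ceval; case: pickP => // t /eqP <-.
by rewrite size_map size_tuple eqxx.
Qed.

Lemma ceval0 n s : ceval (0 : cochain H V n) s = 0.
Proof. by rewrite /ceval; case: pickP => // t _; rewrite ffunE. Qed.

(** A cochain, stored on tuples without 1, can thus be handled as a total function on sequences: the
    last two hypotheses make F vanish wherever [ceval] takes its default value. *)
Lemma ceval_eq n (f : cochain H V n) (F : seq H -> V) :
    (forall t : n.-tuple (nontriv H), f t = F (map val t)) ->
    (forall s, 1%g \in s -> F s = 0) -> (forall s, size s != n -> F s = 0) ->
  ceval f =1 F.
Proof.
move=> Ft F1 Fn s; have [s1|s1] := boolP (1%g \in s).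
  by rewrite F1 // ceval1.
have [/eqP sz|sz] := boolP (size s == n); last by rewrite Fn // ceval_size.
by have [t ->] := nontriv_seqP sz s1; rewrite ceval_val.
Qed.

Lemma ceval_codiff (l r : H -> 'End(V)) n (f : cochain H V n) s :
    1%g \notin s -> size s = n.+1 ->
  ceval (codiff l r n f) s = l (head 1%g s) (ceval f (behead s))
     + \sum_(i < n) (-1) ^+ i.+1 *: ceval f (merge_at s i)
     + (-1) ^+ n.+1 *: r (last 1%g s) (ceval f (take n s)).
Proof.
move=> s1 sz; have [t ->] := nontriv_seqP sz s1.
by rewrite codiffE ceval_val ffunE.
Qed.

End Ceval.

(** Entries equal to 1 are allowed, since both sides are then 0 by normalization. This matters for
    coset walks, which may produce 1 from nontrivial elements. *)
Lemma ceval_codiff_triv (k : fieldType) (H : finGroupType) n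
    (f : cochain H k^o n) u s : size s = n ->
  ceval (GH_codiff k H n f) (u :: s)
    = ceval f s - faces (ceval f) (u :: s).
Proof.
move=> sz; have f1 t : 1%g \in t -> ceval f t = 0 by apply: ceval1.
have [us1|us1] := boolP (1%g \in u :: s).
  rewrite ceval1 //; move: us1; rewrite inE; have [<- _|_ /= s1] := eqVneq.
    by rewrite faces1 // subrr.
  by rewrite f1 // faces_norm // subrr.
rewrite ceval_codiff ?(faces_sum _ (n := n)) //= ?sz //.
rewrite !id_lfunE -addrA; congr (_ + _); rewrite opprD -sumrN; congr (_ + _).
  by apply: eq_bigr => i _; rewrite exprS mulN1r scaleNr.
by rewrite exprS mulN1r scaleNr.
Qed.

(** * Coefficients in the group algebra *)

Section GroupAlgebraCoef.
Variables (k : fieldType) (G : finGroupType).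
Implicit Types (a b : group_algebra k G).

Lemma gcoef_geltl u a y : gcoef (gelt k u * a) y = gcoef a (u^-1 * y)%g.
Proof.
rewrite /gcoef ffunE (bigD1 u) //= big1 => [|v vu].
  by rewrite /gcoef ffunE eqxx mul1r addr0.
by rewrite /gcoef ffunE (negPf vu) mul0r.
Qed.

Lemma gcoef_geltr u a y : gcoef (a * gelt k u) y = gcoef a (y * u^-1)%g.
Proof.
rewrite /gcoef ffunE (bigD1 (y * u^-1)%g) //= big1 => [|v vu].
  by rewrite /gcoef ffunE invMg invgK mulgKV eqxx mulr1 addr0.
rewrite /gcoef ffunE; case: eqP => [E|]; last by rewrite mulr0.
by case/eqP: vu; rewrite -E invMg invgK mulKVg.
Qed.

Lemma gcoefD a b y : gcoef (a + b) y = gcoef a y + gcoef b y.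
Proof. by rewrite /gcoef ffunE. Qed.

Lemma gcoefZ c a y : gcoef (c *: a) y = c * gcoef a y.
Proof. by rewrite /gcoef ffunE. Qed.

Lemma gcoef0 y : gcoef (0 : group_algebra k G) y = 0.
Proof. by rewrite /gcoef ffunE. Qed.

Lemma gcoef_sum I r (P : pred I) (F : I -> group_algebra k G) y :
  gcoef (\sum_(i <- r | P i) F i) y = \sum_(i <- r | P i) gcoef (F i) y.
Proof.
exact: (big_morph (fun a => gcoef a y) (fun a b => gcoefD a b y) (gcoef0 y)).
Qed.

Lemma gcoef_gelt (x y : G) : gcoef (gelt k x) y = (y == x)%:R.
Proof. by rewrite /gcoef ffunE. Qed.

End GroupAlgebraCoef.

(** * Reversed sequences of inverses *)

Definition rev_inv (G : finGroupType) (s : seq G) : seq G :=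
  rev [seq g^-1%g | g <- s].

Lemma rev_invK (G : finGroupType) : involutive (@rev_inv G).
Proof.
move=> s; rewrite /rev_inv map_rev revK -map_comp map_id_in // => g _ /=.
by rewrite invgK.
Qed.

Lemma size_rev_inv (G : finGroupType) (s : seq G) : size (rev_inv s) = size s.
Proof. by rewrite size_rev size_map. Qed.

Lemma rev_inv_cons (G : finGroupType) (u : G) s :
  rev_inv (u :: s) = rcons (rev_inv s) u^-1%g.
Proof. by rewrite /rev_inv /= rev_cons. Qed.

Lemma rev_inv_rcons (G : finGroupType) (u : G) s :
  rev_inv (rcons s u) = u^-1%g :: rev_inv s.
Proof. by rewrite /rev_inv map_rcons rev_rcons. Qed.

Lemma rev_inv_cat (G : finGroupType) (s t : seq G) :
  rev_inv (s ++ t) = rev_inv t ++ rev_inv s.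
Proof. by rewrite /rev_inv map_cat rev_cat. Qed.

Lemma mem1_rev_inv (G : finGroupType) (s : seq G) :
  (1%g \in rev_inv s) = (1%g \in s).
Proof. by rewrite mem_rev -{1}(invg1 G) (mem_map invg_inj). Qed.

Lemma prod_rev_inv (G : finGroupType) (s : seq G) :
  (\prod_(g <- rev_inv s) g = (\prod_(g <- s) g)^-1)%g.
Proof.
elim: s => [|u s IHs]; first by rewrite !big_nil invg1.
by rewrite rev_inv_cons big_rcons IHs big_cons invMg.
Qed.

Lemma seq_split2 (G : finGroupType) (s : seq G) i : (i.+1 < size s)%N ->
  exists s1 a b s2, s = s1 ++ a :: b :: s2 /\ size s1 = i.
Proof.
move=> lt_i; exists (take i s), (nth 1 s i)%g, (nth 1 s i.+1)%g, (drop i.+2 s).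
have lt_i' := ltnW lt_i.
by rewrite -!drop_nth ?cat_take_drop ?size_takel // ltnW.
Qed.

Lemma prod_merge_at (G : finGroupType) (s : seq G) i : (i.+1 < size s)%N ->
  (\prod_(g <- merge_at s i) g = \prod_(g <- s) g)%g.
Proof.
case/seq_split2=> s1 [a [b [s2 [-> <-]]]].
by rewrite merge_at_cat !big_cat /= !big_cons -!mulgA.
Qed.

(** Since (ab)^-1 = b^-1 a^-1, the merged pair stays adjacent after reversal; it is preceded by the
    reversed tail, of length [size s - i.+2]. *)
Lemma merge_at_rev_inv (G : finGroupType) (s : seq G) i : (i.+1 < size s)%N ->
  merge_at (rev_inv s) (size s - i.+2) = rev_inv (merge_at s i).
Proof.
case/seq_split2=> s1 [a [b [s2 [-> <-]]]].
rewrite merge_at_cat !rev_inv_cat !rev_inv_cons -!cats1 -!catA /= invMg.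
have -> : (size (s1 ++ a :: b :: s2) - (size s1).+2 = size (rev_inv s2))%N.
  by rewrite size_cat size_rev_inv /= !addnS !subSS addKn.
exact: merge_at_cat.
Qed.

(** * Hochschild cochains in groupoid coordinates *)

Section Coord.
Variables (k : fieldType) (G : finGroupType).

(* [hh_coord phi s y] is a(s; y) in the notation of the header: multiplying by
   the product of s translates the argument of [gcoef]. *)
Definition hh_coord n (phi : cochain G (group_algebra k G) n) (s : seq G)
    (y : G) : k :=
  inv_sign k n *
    gcoef (ceval phi (rev_inv s)) ((\prod_(g <- s) g)^-1 * y)%g.

(** The exponents are triangular numbers, so consecutive ones differ by n + 1. *)
Lemma inv_signS n : inv_sign k n.+1 = (-1) ^+ n.+1 * inv_sign k n.
Proof.
rewrite /inv_sign -exprD; congr (_ ^+ _).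
by rewrite mulnC -[n.+2]addn2 mulnDl mul2n addnC halfD odd_double doubleK.
Qed.

Lemma inv_sign_sqr n : inv_sign k n * inv_sign k n = 1.
Proof. by rewrite -expr2 sqrr_sign. Qed.

Lemma hh_coord1 n (phi : cochain G (group_algebra k G) n) s y :
  1%g \in s -> hh_coord phi s y = 0.
Proof.
by move=> s1; rewrite /hh_coord ceval1 ?gcoef0 ?mulr0 // mem1_rev_inv.
Qed.

Lemma hh_coord_size n (phi : cochain G (group_algebra k G) n) s y :
  size s != n -> hh_coord phi s y = 0.
Proof.
by move=> sz; rewrite /hh_coord ceval_size ?gcoef0 ?mulr0 // size_rev_inv.
Qed.

Lemma hh_coordP n s y a (phi psi : cochain G (group_algebra k G) n) :
  hh_coord (a *: phi + psi) s y = a * hh_coord phi s y + hh_coord psi s y.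
Proof. by rewrite /hh_coord ceval_is_linear gcoefD gcoefZ; ring. Qed.

Lemma hh_coord0 n s y : hh_coord (0 : cochain G (group_algebra k G) n) s y = 0.
Proof. by rewrite /hh_coord ceval0 gcoef0 mulr0. Qed.

Lemma hh_coordB n (phi psi : cochain G (group_algebra k G) n) s y :
  hh_coord (phi - psi) s y = hh_coord phi s y - hh_coord psi s y.
Proof. by rewrite addrC -scaleN1r hh_coordP mulN1r addrC. Qed.

Lemma hat_coord n (phi : cochain G (group_algebra k G) n) x :
  ceval (hat phi x) =1 fun s => hh_coord phi (map sgval s) x.
Proof.
apply: ceval_eq => [t|s s1|s sz] /=; last by rewrite hh_coord_size ?size_map.
  by rewrite ffunE /= gcoefZ gcoef_geltl /hh_coord /rev_inv -!map_comp.
by rewrite hh_coord1 //; apply/mapP; exists 1%g.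
Qed.

(** Up to a sign, (s, y) is only reparametrized: the coefficient of y in the value at t is read off
    at the reversed inverses of t and at y multiplied by their product. *)
Lemma hh_coord_inj n (phi psi : cochain G (group_algebra k G) n) :
  (forall s y, size s = n -> hh_coord phi s y = hh_coord psi s y) -> phi = psi.
Proof.
move=> E; apply/ffunP=> t; apply/ffunP=> y.
have := E (rev_inv (map val t)) ((\prod_(g <- rev_inv (map val t)) g) * y)%g.
rewrite size_rev_inv size_map size_tuple => /(_ erefl).
rewrite /hh_coord rev_invK !ceval_val mulKg => /(congr1 ( *%R (inv_sign k n))).
by rewrite !mulrA inv_sign_sqr !mul1r.
Qed.

Lemma hat_is_linear n x :
  linear (fun phi : cochain G (group_algebra k G) n => hat phi x).
Proof.
move=> a phi psi; apply/ffunP=> t.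
by rewrite -!ceval_val ceval_is_linear !hat_coord hh_coordP.
Qed.

Lemma hat0 n x : hat (0 : cochain G (group_algebra k G) n) x = 0.
Proof. by apply/ffunP=> t; rewrite -ceval_val hat_coord hh_coord0 ffunE. Qed.

(** Reversal exchanges the outer faces: the term multiplied on the right by u^-1 becomes the first
    face, with y moved to y ^ u, and the term multiplied on the left becomes the last face. The
    quotient (-1)^(n+1) of consecutive values of [inv_sign] corrects the signs. *)
Lemma hh_coord_codiff n (phi : cochain G (group_algebra k G) n) u s y :
    size s = n ->
  hh_coord (HH_codiff k G n phi) (u :: s) y
    = hh_coord phi s (y ^ u)%g - faces (hh_coord phi ^~ y) (u :: s).
Proof.
move=> sz.
have phi1 t z : 1%g \in t -> hh_coord phi t z = 0 by apply: hh_coord1.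
have [us1|us1] := boolP (1%g \in u :: s).
  rewrite hh_coord1 //; move: us1; rewrite inE; have [<- _|_ /= s1] := eqVneq.
    by rewrite faces1 ?conjg1 ?subrr // => t; apply: phi1.
  by rewrite phi1 // faces_norm ?subrr // => t; apply: phi1.
rewrite (faces_sum (V := k^o) _ (n := n)) /= ?sz // {1}/hh_coord.
rewrite ceval_codiff ?mem1_rev_inv ?size_rev_inv /= ?sz //.
rewrite !gcoefD gcoef_sum gcoefZ !lfunE /= gcoef_geltl gcoef_geltr.
set r := rev_inv _; set p := (\prod_(g <- u :: s) g)%g.
have takeE : take n (u :: s) = belast u s.
  by rewrite lastI -sz -(size_belast u) -cats1 take_size_cat.
have -> : hh_coord phi s (y ^ u)%g = inv_sign k n *
    gcoef (ceval phi (take n r)) (p^-1 * y * (last 1 r)^-1)%g.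
  rewrite /r rev_inv_cons last_rcons -cats1 take_size_cat ?size_rev_inv //.
  by rewrite /hh_coord /p big_cons invgK invMg conjgE !mulgA.
have -> : hh_coord phi (take n (u :: s)) y = inv_sign k n *
    gcoef (ceval phi (behead r)) ((head 1 r)^-1 * (p^-1 * y))%g.
  rewrite takeE /r /p (lastI u s) rev_inv_rcons /= /hh_coord big_rcons.
  by rewrite invgK invMg !mulgA mulgV mul1g.
(* The inner face i of [u :: s] corresponds to the inner face n - 1 - i of r. *)
rewrite (reindex_inj rev_ord_inj) /= inv_signS.
have -> : \sum_(i < n)
      gcoef ((-1) ^+ (n - i.+1).+1 *: ceval phi (merge_at r (n - i.+1)))
        (p^-1 * y)
    = (-1) ^+ n * inv_sign k n
      * \sum_(i < n) (-1) ^+ i * hh_coord phi (merge_at (u :: s) i) y.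
  rewrite mulr_sumr; apply: eq_bigr => i _; rewrite gcoefZ.
  have lti : (i.+1 < size (u :: s))%N by rewrite /= sz ltnS.
  have -> : (n - i.+1 = size (u :: s) - i.+2)%N by rewrite /= sz.
  rewrite merge_at_rev_inv // /hh_coord prod_merge_at // -/p.
  set g := gcoef _ _; set c := inv_sign k n.
  rewrite /= sz subSS -subSn // subSS.
  have -> : (-1) ^+ n = (-1) ^+ (n - i) * (-1) ^+ i :> k.
    by rewrite -exprD subnK // ltnW.
  have cc : c * c = 1 := inv_sign_sqr n.
  have ii : (-1) ^+ i * (-1) ^+ i = 1 :> k by rewrite -expr2 sqrr_sign.
  (* Inserting squares of signs, which equal 1, leaves a polynomial identity; the same device closes
     the whole computation below. *)
  transitivity ((-1) ^+ (n - i) * g * (c * c) * ((-1) ^+ i * (-1) ^+ i)).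
    by rewrite cc ii !mulr1.
  ring.
set gB := gcoef _ (_ * _ * _)%g; set gA := gcoef _ _; set S := \sum_(i < n) _.
have cc := inv_sign_sqr n.
have nn : (-1) ^+ n * (-1) ^+ n = 1 :> k by rewrite -expr2 sqrr_sign.
rewrite exprS mulN1r.
move: cc nn; set c := inv_sign k n; set N := (-1) ^+ n => cc nn.
transitivity (- (N * (c * gA)) - S * (N * N) * (c * c) + N * N * (c * gB)).
  by ring.
rewrite cc nn; rewrite -[N *: _]/(N * _); ring.
Qed.

End Coord.

(** * The retraction onto one isotropy group and its prism operator *)

Section Walk.
Variables (k : fieldType) (G : finGroupType).
Variables (gamma : forall x : G, 'I_(class_size x) -> G) (x : G).
Hypothesis reps : coset_reps gamma x.
Implicit Types (i : 'I_(class_size x)) (u : G) (s : seq G).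
Implicit Types (b : seq G -> k) (F : seq (Cent x) -> k^o).

Lemma coset_stepE i u :
  (gamma i * u
     = sgval (coset_step gamma i u).1 * gamma (coset_step gamma i u).2)%g.
Proof. by apply/(coset_stepP i u reps); rewrite -surjective_pairing. Qed.

Lemma coset_step1 i : coset_step gamma i 1%g = (1%g, i).
Proof. by apply/(coset_stepP _ _ reps); rewrite mulg1 mul1g. Qed.

(** The centralizer component is a cocycle for the right action of G on the cosets. This is
    functoriality of the retraction, and it makes [coset_walk] compatible with merging. *)
Lemma coset_stepM i u v :
  let p := coset_step gamma i u in let q := coset_step gamma p.2 v in
  coset_step gamma i (u * v)%g = ((p.1 * q.1)%g, q.2).
Proof.
apply/(coset_stepP _ _ reps).
by rewrite mulgA coset_stepE -mulgA coset_stepE mulgA.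
Qed.

Lemma cent_conj (h : Cent x) (g : G) : (x ^ (sgval h * g))%g = (x ^ g)%g.
Proof.
have /cent1P hx : sgval h \in 'C[x]%g := subgP h.
by rewrite conjgM [(x ^ sgval h)%g]conjgE -hx mulKg.
Qed.

Lemma conj_gamma_step i u :
  ((x ^ gamma i) ^ u)%g = (x ^ gamma (coset_step gamma i u).2)%g.
Proof. by rewrite -conjgM coset_stepE cent_conj. Qed.

Lemma size_coset_walk i s : size (coset_walk gamma i s) = size s.
Proof. by elim: s i => //= u s IHs i; rewrite IHs. Qed.

Lemma coset_walk1 i s : 1%g \in s -> 1%g \in coset_walk gamma i s.
Proof.
elim: s i => // u s IHs i; rewrite !inE /=; have [<- _|_ /= s1] := eqVneq.
  by rewrite coset_step1 eqxx.
by rewrite IHs ?orbT.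
Qed.

Lemma faces_walk F i s :
  faces (fun t => F (coset_walk gamma i t)) s = faces F (coset_walk gamma i s).
Proof.
elim: s F i => [|u [|v s] IHs] F i //.
rewrite [coset_walk _ _ (u :: _)]/= !faces_cons /= coset_stepM.
by congr (_ - _); apply: (IHs (fun t => F (_ :: t))).
Qed.

(* The homotopy between the identity and the retraction onto the isotropy
   group at x, along the arrows gamma_i : x -> x ^ gamma_i. *)
Fixpoint prism b i s : k :=
  if s is u :: s' then
    let p := coset_step gamma i u in
    b (gamma i :: s) - prism (fun t => b (sgval p.1 :: t)) p.2 s'
  else b [:: gamma i].

Lemma prism_cons b i u s :
  let p := coset_step gamma i u in
  prism b i (u :: s)
    = b (gamma i :: u :: s) - prism (fun t => b (sgval p.1 :: t)) p.2 s.
Proof. by []. Qed.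

(** Every term of the prism evaluates b on a sequence one longer than s, hence nonempty, so default
    values at [[::]] do not matter. *)
Lemma eq_prism b b' i s :
    (forall v t, size t = size s -> b (v :: t) = b' (v :: t)) ->
  prism b i s = prism b' i s.
Proof.
elim: s b b' i => [|u s IHs] b b' i eqb /=; rewrite eqb //.
by congr (_ - _); apply: IHs => v t st; apply: eqb; rewrite /= st.
Qed.

Lemma prismB b b' i s :
  prism (fun t => b t - b' t) i s = prism b i s - prism b' i s.
Proof.
elim: s b b' i => [|u s IHs] b b' i //.
rewrite !prism_cons (IHs (fun t => b (_ :: t)) (fun t => b' (_ :: t))); ring.
Qed.

Lemma prism0 i s : prism (fun=> 0) i s = 0.
Proof. by elim: s i => //= u s IHs i; rewrite IHs subrr. Qed.

(** Consecutive prism simplices share the face on which gamma_i u = h gamma_s is merged, with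
    opposite signs. The faces away from the inserted arrow cancel against the second sum, and only
    the face dropping the final arrow survives: the walk. *)
Lemma prism_faces b i s :
  prism (faces b) i s + faces (prism b i) s
    = b (map sgval (coset_walk gamma i s)).
Proof.
elim: s b i => [|u s IHs] b i; first by rewrite /= /faces addr0.
rewrite prism_cons /=; set p := coset_step gamma i u.
pose bh t := b (sgval p.1 :: t).
(* m is the first merge in [faces b (h :: t)], with h the first walk element, and bh carries the
   remaining faces. The default 0 is never reached. *)
pose m t := if t is v :: t' then b (sgval p.1 * v :: t')%g else 0.
rewrite (@eq_prism _ (fun t => m t - faces bh t)) => [|v t _]; last first.
  by rewrite faces_cons.
rewrite prismB -[RHS]/(bh _) -IHs; case: s IHs => [|v s] IHs.
  rewrite faces_cons /faces /= coset_stepE -/p; ring.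
set q := coset_step gamma p.2 v.
rewrite !faces_cons prism_cons -/q.
rewrite (@eq_faces _ _ (fun t => prism b i (u :: t))
  (fun t => b (gamma i :: u :: t) - prism bh p.2 t)) //.
rewrite facesB [prism b i _]prism_cons coset_stepM -/p -/q /=.
by rewrite (coset_stepE i u) -/p; ring.
Qed.

(** An entry 1 of s either remains in a prism simplex or has been replaced by its walk element,
    which is again 1. Normalization thus passes to the homotopy. *)
Lemma prism1 b i s : (forall t, 1%g \in t -> b t = 0) -> 1%g \in s ->
  prism b i s = 0.
Proof.
elim: s b i => // u s IHs b i b1 us1; rewrite prism_cons b1; last first.
  by rewrite in_cons us1 orbT.
rewrite sub0r; apply/eqP; rewrite oppr_eq0; apply/eqP.
move: us1; rewrite inE; have [<- _|_ /= s1] := eqVneq.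
  rewrite coset_step1 //= (@eq_prism _ (fun=> 0)) ?prism0 // => v t _.
  by rewrite b1 ?mem_head.
by apply: IHs => // t t1; rewrite b1 // inE t1 orbT.
Qed.

Lemma prism_size b i s n : (forall t, size t != n.+1 -> b t = 0) ->
  size s != n -> prism b i s = 0.
Proof.
elim: s b i n => [|u s IHs] b i n bn sz; first by rewrite /= bn.
rewrite prism_cons bn // sub0r; apply/eqP; rewrite oppr_eq0; apply/eqP.
case: n bn sz => [|n] bn sz.
  rewrite (@eq_prism _ (fun=> 0)) ?prism0 // => v t _.
  by rewrite bn.
by apply: (IHs _ _ n) => // t tn; apply: bn.
Qed.

(* [prism] contracts the groupoid differential
   a |-> (u :: s, y) |-> a (s, y ^ u) - faces (a (-, y)) (u :: s). *)
Lemma prism_homotopy (a : seq G -> G -> k) i s :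
  let d t := if t is u :: t' then
               a t' (x ^ u)%g - faces (a ^~ x) t else 0 in
  let b t := a t x in
  prism d i s + (if s is u :: s' then
    prism b (coset_step gamma i u).2 s' - faces (prism b i) s else 0)
  = a s (x ^ gamma i)%g - a (map sgval (coset_walk gamma i s)) x.
Proof.
(* e isolates the first face, the only one that moves the base point. *)
move=> d b; pose e t := if t is u :: t' then a t' (x ^ u)%g else 0.
rewrite (@eq_prism _ (fun t => e t - faces b t)) // prismB.
rewrite -[a _ x]/(b _) -prism_faces //.
case: s => [|u s]; first by rewrite /faces /= !addr0.
rewrite [prism e _ _]prism_cons.
set h := sgval (coset_step gamma i u).1.
(* After the first term the leading arrow h centralizes x, so dropping it leaves the base point
   unchanged. *)
rewrite (@eq_prism (fun t => e (h :: t)) b) => [|v t _]; last first.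
  by rewrite /e -[h]mulg1 cent_conj // conjg1.
by rewrite [e _]/=; ring.
Qed.

(** At the representative 1, a step along h in the centralizer returns h and the same index. *)
Lemma coset_walk_cent i (s : seq (Cent x)) :
  i = 0%N :> nat -> coset_walk gamma i (map sgval s) = s.
Proof.
move=> i0; elim: s => //= h s IHs.
have -> : coset_step gamma i (sgval h) = (h, i); last by rewrite /= IHs.
by apply/coset_stepP=> //; rewrite (reps.1 _ i0) mulg1 mul1g.
Qed.

End Walk.

(** * Linear maps out of cohomology *)

Lemma linear_sig (k : fieldType) (U W : lmodType k) (h : U -> W) :
  linear h -> {F : {linear U -> W} | F =1 h}.
Proof.
move=> lin_h; pose hL := GRing.isLinear.Build k U W _ h lin_h.
pose F : {linear U -> W} := HB.pack h hL.
by exists F.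
Qed.

Section CohomologyClass.
Variables (k : fieldType) (H : finGroupType) (V : vectType k).
Variables (l r : H -> 'End(V)) (n : nat).

Definition coh_repr (u : cohomology l r n) : cochain H V n :=
  vsval (generic_quotient.repr u).

Lemma coh_repr_cocycle u : coh_repr u \in cocycles l r n.
Proof. exact: subvsP. Qed.

Lemma coh_reprK u : coh_class l r (coh_repr u) = u.
Proof. by rewrite /coh_class /coh_repr vsvalK generic_quotient.reprK. Qed.

Lemma coh_class_is_linear : linear (@coh_class k H V l r n).
Proof.
by move=> a f g; rewrite /coh_class linearP raddfD /= -vquot_scaleE.
Qed.

(** The lift evaluates h at chosen representatives. It is linear because the representative of a
    combination and the combination of representatives are cohomologous cocycles. *)
Lemma coh_lift (W : lmodType k) (h : cochain H V n -> W) : linear h ->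
    (forall f g, f \in cocycles l r n -> g \in cocycles l r n ->
       coh_class l r f = coh_class l r g -> h f = h g) ->
  {F : {linear cohomology l r n -> W} |
    forall f, f \in cocycles l r n -> F (coh_class l r f) = h f}.
Proof.
move=> lin_h hcongr.
have [|F FE] := @linear_sig k (cohomology l r n) W (fun u => h (coh_repr u)).
  move=> a u v; rewrite -lin_h; apply: hcongr; rewrite ?coh_repr_cocycle //.
    by rewrite rpredD ?rpredZ ?coh_repr_cocycle.
  by rewrite coh_class_is_linear !coh_reprK.
exists F => f Zf; rewrite FE; apply: hcongr; rewrite ?coh_repr_cocycle //.
exact: coh_reprK.
Qed.

End CohomologyClass.

(** * Assembly over the conjugacy classes *)

Section Decomposition.
Variables (k : fieldType) (G : finGroupType) (X : {set G}).
Hypothesis hX : is_transversal X (classes [set: G]) [set: G].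
Variable gamma : forall x : G, 'I_(class_size x) -> G.
Hypothesis hgamma : forall x : G, x \in X -> coset_reps gamma x.

Local Notation idx := {x : G | x \in X}.
Local Notation ords x := 'I_(class_size (val x)).
Local Notation family n := (forall x : idx, cochain (Cent (val x)) k^o n).

Let reps (x : idx) : coset_reps gamma (val x) := hgamma (valP x).

Lemma transversal_classes y : exists2 x : idx, (exists g, y = val x ^ g)%g &
  forall x' : idx, (exists g, y = val x' ^ g)%g -> x' = x.
Proof.
have /and3P[_ _ /forall_inP/(_ (y ^: [set: G])%g)] := hX.
rewrite mem_classes ?inE // => /(_ isT)/cards1P[x Xx].
have mem x' : x' \in X -> (exists g, y = x' ^ g)%g -> x' = x.
  move=> Xx' [g yE]; apply/set1P; rewrite -Xx inE Xx' /=.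
  by apply/imsetP; exists g^-1%g; rewrite ?inE // yE conjgK.
have : x \in [set x] by rewrite inE.
rewrite -Xx inE => /andP[xX /imsetP[g _ xE]].
exists (Sub x xX) => [|x' /mem xx'].
  by exists g^-1%g; rewrite /= xE conjgK.
by apply: val_inj; rewrite /= xx' // (valP x').
Qed.

(** The conjugacy class determines x; then gamma_i gamma_i'^-1 centralizes x, so both indices name
    the same coset. The equality is between tagged pairs because the type of the index depends on
    x. *)
Lemma conj_gamma_inj (x x' : idx) (i : ords x) (i' : ords x') :
    (val x ^ gamma i = val x' ^ gamma i')%g ->
  Tagged (fun x : idx => ords x) i = Tagged _ i'.
Proof.
move=> E; have [x0 _ x0P] := transversal_classes (val x ^ gamma i)%g.
have xx' : x = x'.
  have -> : x = x0 by apply: x0P; exists (gamma i).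
  by apply/esym/x0P; exists (gamma i').
case: _ / xx' i' E => i' E; congr (Tagged _ _).
have [j [_ Uj]] := (reps x).2 (gamma i).
transitivity j; first by apply/esym/Uj; rewrite mem_rcoset mulgV group1.
apply: Uj; rewrite mem_rcoset; apply/cent1P; rewrite /commute.
move: E; set g := gamma i; set g' := gamma i'; rewrite !conjgE => E.
have xg : (val x * g = g * (g'^-1 * (val x * g')))%g by rewrite -E mulKVg.
by rewrite [RHS]mulgA xg -!mulgA mulgV mulg1.
Qed.

Lemma conj_gamma_surj y : exists (x : idx) (i : ords x),
  y = (val x ^ gamma i)%g.
Proof.
have [x [g ->] _] := transversal_classes y.
have [i [gi _]] := (reps x).2 g; exists x, i.
move: gi; rewrite mem_rcoset => gi.
rewrite -(cent_conj (subg _ (g * (gamma i)^-1)%g) (gamma i)) subgK //.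
by rewrite mulgKV.
Qed.

(** The cochain with prescribed coordinates A at the points x ^ gamma_i, the common shape of [unhat]
    and of the homotopy. *)
Definition of_coords n (A : forall x : idx, ords x -> seq G -> k) :
    cochain G (group_algebra k G) n :=
  [ffun t : n.-tuple (nontriv G) =>
     let g := [seq val u | u <- t] in
     inv_sign k n *: (gelt k (\prod_(u <- g) u)%g *
       \sum_(x : idx) \sum_(i < class_size (val x))
         A x i (rev [seq u^-1%g | u <- g]) *: gelt k (val x ^ gamma i)%g)].

(** Signs and products cancel, and by [conj_gamma_inj] a single summand meets the point x ^
    gamma_i. *)
Lemma hh_coord_of_coords (n : nat)
    (A : forall x : idx, ords x -> seq G -> k)
    (x : idx) (i : ords x) (s : seq G) :
    (forall (x : idx) (i : ords x) s, 1%g \in s -> A x i s = 0) ->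
    (forall (x : idx) (i : ords x) s, size s != n -> A x i s = 0) ->
  hh_coord (of_coords n A) s (val x ^ gamma i)%g = A x i s.
Proof.
move=> A1 An; pose B (s : seq G) : group_algebra k G := \sum_(x : idx)
  \sum_(i < class_size (val x)) A x i (rev_inv s) *: gelt k (val x ^ gamma i)%g.
have B0 t : (forall x (i : ords x), A x i (rev_inv t) = 0) -> B t = 0.
  move=> A0; rewrite /B big1 // => z _; rewrite big1 // => j _.
  by rewrite A0 scale0r.
have cE : ceval (of_coords n A) =1
    fun s => inv_sign k n *: (gelt k (\prod_(u <- s) u)%g * B s).
  apply: ceval_eq => [t|t t1|t tn]; first by rewrite ffunE.
    by rewrite B0 ?mulr0 ?scaler0 // => z j; rewrite A1 // mem1_rev_inv.
  by rewrite B0 ?mulr0 ?scaler0 // => z j; rewrite An // size_rev_inv.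
rewrite /hh_coord cE gcoefZ gcoef_geltl mulrA inv_sign_sqr mul1r prod_rev_inv.
rewrite invgK mulKVg /B rev_invK gcoef_sum (bigD1 x) //= gcoef_sum.
rewrite (bigD1 i) //=.
rewrite gcoefZ gcoef_gelt eqxx mulr1 !big1 ?addr0 // => [z zx|j ji].
  rewrite gcoef_sum big1 // => j _; rewrite gcoefZ gcoef_gelt.
  case: eqP => [/conj_gamma_inj E|]; last by rewrite mulr0.
  by case/eqP: zx; move/(congr1 tag): E.
rewrite gcoefZ gcoef_gelt.
case: eqP => [/conj_gamma_inj E|]; last by rewrite mulr0.
by case/eqP: ji; apply/esym/eqP; move/eqP: E; rewrite eq_Tagged.
Qed.

Lemma hh_coord_gamma_inj n (phi psi : cochain G (group_algebra k G) n) :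
    (forall s (x : idx) (i : ords x), size s = n ->
       hh_coord phi s (val x ^ gamma i)%g
         = hh_coord psi s (val x ^ gamma i)%g) ->
  phi = psi.
Proof.
move=> E; apply: hh_coord_inj => s y sz.
by have [x [i ->]] := conj_gamma_surj y; apply: E.
Qed.

Lemma hh_coord_unhat n (psi : family n) (x : idx) (i : ords x) s :
  hh_coord (unhat gamma psi) s (val x ^ gamma i)%g
    = ceval (psi x) (coset_walk gamma i s).
Proof.
pose A x i s := ceval (psi x) (coset_walk gamma i s).
(* [unhat gamma psi] is [of_coords n A] by conversion. *)
apply: (hh_coord_of_coords (A := A)); rewrite /A.
  by move=> z j t t1; rewrite ceval1 // coset_walk1.
by move=> z j t tn; rewrite ceval_size // size_coset_walk.
Qed.

(** Elements of the centralizer fix x, so the first face loses its twist and the groupoid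
    differential becomes the one with trivial coefficients. *)
Lemma hat_codiff n (phi : cochain G (group_algebra k G) n) x :
  hat (HH_codiff k G n phi) x = GH_codiff k (Cent x) n (hat phi x).
Proof.
apply/ffunP=> t; rewrite -!ceval_val hat_coord.
case: (map val t) (size_tuple t) (size_map val t) => [|u s] -> //= [sz].
rewrite hh_coord_codiff ?size_map // ceval_codiff_triv // !hat_coord.
rewrite -[sgval u]mulg1 cent_conj // conjg1 mulg1; congr (_ - _).
rewrite (eq_faces _ (@hat_coord _ _ _ phi x)); apply/esym.
exact: (faces_map (hh_coord phi ^~ x)).
Qed.

(** The first face moves x ^ gamma_i to the point of the next coset, exactly where the tail of the
    walk starts; the other faces commute with walking. *)
Lemma unhat_codiff n (psi : family n) :
  unhat gamma (fun x => GH_codiff k (Cent (val x)) n (psi x))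
    = HH_codiff k G n (unhat gamma psi).
Proof.
apply: hh_coord_gamma_inj => -[|u s] x i //= [sz].
rewrite hh_coord_unhat hh_coord_codiff // (conj_gamma_step (reps x)).
rewrite hh_coord_unhat ceval_codiff_triv ?size_coset_walk //; congr (_ - _).
transitivity (faces (fun t => ceval (psi x) (coset_walk gamma i t)) (u :: s)).
  by rewrite (faces_walk (reps x) (ceval (psi x))).
by apply: eq_faces => t; rewrite hh_coord_unhat.
Qed.

Lemma class_size_gt0 (x : G) : (0 < class_size x)%N.
Proof. by rewrite card_gt0; apply/set0Pn; exists x; apply: class_refl. Qed.

Lemma hat_unhat n (psi : family n) (x : idx) :
  hat (unhat gamma psi) (val x) = psi x.
Proof.
apply/ffunP=> t; rewrite -!ceval_val hat_coord.
pose i := Ordinal (class_size_gt0 (val x)).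
have := hh_coord_unhat psi i (map sgval (map val t)).
by rewrite ((reps x).1 i) // conjg1 coset_walk_cent.
Qed.

Definition prism_cochain n (phi : cochain G (group_algebra k G) n.+1) :
    cochain G (group_algebra k G) n :=
  of_coords n (fun x i s => prism gamma (fun t => hh_coord phi t (val x)) i s).

Lemma hh_coord_prism_cochain n (phi : cochain G (group_algebra k G) n.+1)
    (x : idx) (i : ords x) s :
  hh_coord (prism_cochain phi) s (val x ^ gamma i)%g
    = prism gamma (fun t => hh_coord phi t (val x)) i s.
Proof.
rewrite hh_coord_of_coords // => z j t.
  by apply: prism1 => // u; apply: hh_coord1.
by apply: prism_size => u; apply: hh_coord_size.
Qed.

(** In [prism_homotopy] the prism of the differential vanishes on a cocycle; the other term is the
    differential of [prism_cochain phi]. *)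
Lemma hat_homotopy n (phi : cochain G (group_algebra k G) n) :
    HH_codiff k G n phi = 0 ->
  phi - unhat gamma (fun x : idx => hat phi (val x))
    \in HH_coboundaries k G n.
Proof.
move=> dphi0; pose a := hh_coord phi.
have H s (x : idx) (i : ords x) : size s = n ->
    hh_coord (phi - unhat gamma (fun x : idx => hat phi (val x))) s
      (val x ^ gamma i)%g
    = if s is u :: s' then
        prism gamma (a ^~ (val x)) (coset_step gamma i u).2 s'
        - faces (prism gamma (a ^~ (val x)) i) s
      else 0.
  move=> sz; rewrite hh_coordB hh_coord_unhat hat_coord.
  rewrite -(prism_homotopy (reps x) a).
  rewrite (@eq_prism _ _ _ _ _ (fun=> 0)) => [|v t st].
    by rewrite prism0 add0r.
  by rewrite -[a t _ - _]hh_coord_codiff ?st // dphi0 hh_coord0.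
(* In degree 0 the only coboundary is 0, and the difference itself vanishes because s is empty. *)
case: n phi dphi0 @a H => [|n] phi dphi0 a H.
  rewrite memv0; apply/eqP/hh_coord_gamma_inj => s x i sz.
  by rewrite H // hh_coord0; case: s sz.
suff -> : phi - unhat gamma (fun x : idx => hat phi (val x))
    = HH_codiff k G n (prism_cochain phi) by rewrite memv_img ?memvf.
apply: hh_coord_gamma_inj => s x i sz; rewrite H //.
case: s sz => // u s [sz]; rewrite hh_coord_codiff //.
rewrite (conj_gamma_step (reps x)) hh_coord_prism_cochain; congr (_ - _).
by apply: eq_faces => t; rewrite hh_coord_prism_cochain.
Qed.

(** Families are dependent functions, so pointwise equality is transported here without function
    extensionality. *)
Lemma eq_unhat n (psi psi' : family n) :
  (forall x, psi x = psi' x) -> unhat gamma psi = unhat gamma psi'.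
Proof.
move=> E; apply: hh_coord_gamma_inj => s x i _.
by rewrite !hh_coord_unhat E.
Qed.

Lemma unhat_is_linear n a (psi psi' : family n) :
  unhat gamma (fun x => a *: psi x + psi' x)
    = a *: unhat gamma psi + unhat gamma psi'.
Proof.
apply: hh_coord_gamma_inj => s x i _.
by rewrite hh_coordP !hh_coord_unhat ceval_is_linear.
Qed.

Lemma unhat0 n :
  unhat gamma (fun x : idx => 0 : cochain (Cent (val x)) k^o n) = 0.
Proof.
apply: hh_coord_gamma_inj => s x i _.
by rewrite hh_coord_unhat hh_coord0 ceval0.
Qed.

Lemma hat_cocycle n (phi : cochain G (group_algebra k G) n) x :
  phi \in HH_cocycles k G n -> hat phi x \in GH_cocycles k (Cent x) n.
Proof. by rewrite !memv_ker => /eqP phi0; rewrite -hat_codiff phi0 hat0. Qed.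

Lemma hat_coboundary n (phi : cochain G (group_algebra k G) n) x :
    phi \in HH_coboundaries k G n ->
  hat phi x \in GH_coboundaries k (Cent x) n.
Proof.
case: n phi => [|n] phi /=.
  by rewrite memv0 => /eqP->; rewrite hat0 memv0.
by case/memv_imgP=> eta _ ->; rewrite hat_codiff memv_img ?memvf.
Qed.

Lemma unhat_cocycle n (psi : family n) :
    (forall x, psi x \in GH_cocycles k (Cent (val x)) n) ->
  unhat gamma psi \in HH_cocycles k G n.
Proof.
move=> Zpsi; rewrite memv_ker -unhat_codiff; apply/eqP.
rewrite -[RHS](unhat0 n.+1); apply: eq_unhat => x.
by apply/eqP; rewrite -memv_ker; apply: Zpsi.
Qed.

Lemma unhat_coboundary n (psi : family n) :
    (forall x, psi x \in GH_coboundaries k (Cent (val x)) n) ->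
  unhat gamma psi \in HH_coboundaries k G n.
Proof.
case: n psi => [|n] psi Bpsi.
  rewrite (eq_unhat (psi' := fun x => 0)) ?unhat0 ?mem0v // => x.
  by apply/eqP; rewrite -memv0; apply: Bpsi.
pose d (x : idx) := GH_codiff k (Cent (val x)) n.
(* The linear inverse of each differential supplies preimages for all x at once. *)
rewrite (eq_unhat (psi' := fun x => d x ((d x)^-1 (psi x))%VF)) => [|x].
  by rewrite /d unhat_codiff memv_img ?memvf.
by rewrite limg_lfunVK ?Bpsi.
Qed.

Lemma eq_unhat_class n (psi psi' : family n) :
    (forall x, psi x \in GH_cocycles k (Cent (val x)) n) ->
    (forall x, psi' x \in GH_cocycles k (Cent (val x)) n) ->
    (forall x, GH_class (psi x) = GH_class (psi' x)) ->
  HH_class (unhat gamma psi) = HH_class (unhat gamma psi').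
Proof.
move=> Zpsi Zpsi' E; apply/coh_classP; try exact: unhat_cocycle.
rewrite addrC -scaleN1r -unhat_is_linear; apply: unhat_coboundary => x.
by rewrite scaleN1r addrC; apply/coh_classP.
Qed.

End Decomposition.

Theorem theorem5p1 (k : fieldType) (G : finGroupType) (X : {set G})
    (hX : is_transversal X (classes [set: G]) [set: G])
    (gamma : forall x : G, 'I_(class_size x) -> G)
    (hgamma : forall x : G, x \in X -> coset_reps gamma x) :
  exists (F : forall n : nat, {linear HH k G n ->
                 dirsum (fun x : {x : G | x \in X} => GH k (Cent (val x)) n)})
         (F' : forall n : nat,
                 {linear dirsum (fun x : {x : G | x \in X} =>
                            GH k (Cent (val x)) n) -> HH k G n}),
  forall n : nat,
  [/\ cancel (F n) (F' n),
      cancel (F' n) (F n),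
      forall phi : cochain G (group_algebra k G) n,
        phi \in HH_cocycles k G n ->
        (forall x : {x : G | x \in X},
           hat phi (val x) \in GH_cocycles k (Cent (val x)) n) /\
        F n (HH_class phi) =
          [ffun x : {x : G | x \in X} => GH_class (hat phi (val x))]
    & forall psi : forall x : {x : G | x \in X}, cochain (Cent (val x)) k^o n,
        (forall x : {x : G | x \in X},
           psi x \in GH_cocycles k (Cent (val x)) n) ->
        unhat gamma psi \in HH_cocycles k G n /\
        F' n [ffun x : {x : G | x \in X} => GH_class (psi x)] =
          HH_class (unhat gamma psi)].
Proof.
pose h n (phi : cochain G (group_algebra k G) n) :
  dirsum (fun x : {x : G | x \in X} => GH k (Cent (val x)) n) :=
  [ffun x : {x : G | x \in X} => GH_class (hat phi (val x))].
have h_lin n : linear (@h n).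
  move=> a phi psi; apply/ffunP=> x.
  by rewrite !ffunE hat_is_linear coh_class_is_linear.
have hcongr n phi psi :
    phi \in HH_cocycles k G n -> psi \in HH_cocycles k G n ->
    HH_class phi = HH_class psi -> h n phi = h n psi.
  move=> Zphi Zpsi /(coh_classP Zphi Zpsi) B; apply/ffunP=> x; rewrite !ffunE.
  apply/coh_classP; rewrite ?hat_cocycle // addrC -scaleN1r -hat_is_linear.
  by rewrite hat_coboundary // scaleN1r addrC.
pose hF n := coh_lift (h_lin n) (hcongr n).
(* The inverse is built from componentwise cocycle representatives; [eq_unhat_class] makes the
   result independent of them, hence linear. *)
pose r n (w : dirsum (fun x : {x : G | x \in X} => GH k (Cent (val x)) n)) x :=
  coh_repr (w x).
have r_cocycle n w x : r n w x \in GH_cocycles k (Cent (val x)) n.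
  exact: coh_repr_cocycle.
pose h' n w := HH_class (unhat gamma (r n w)).
have h'_lin n : linear (h' n).
  move=> a w w'; rewrite /h' -coh_class_is_linear -unhat_is_linear //.
  apply: eq_unhat_class => // x.
    by rewrite rpredD ?rpredZ ?r_cocycle.
  by rewrite coh_class_is_linear !coh_reprK !ffunE.
pose hF' n := linear_sig (h'_lin n).
exists (fun n => sval (hF n)), (fun n => sval (hF' n)) => n.
case: (hF n) (hF' n) => F FE [F' F'E] /=.
have FZ phi : phi \in HH_cocycles k G n -> (forall x : {x : G | x \in X},
    hat phi (val x) \in GH_cocycles k (Cent (val x)) n) /\
    F (HH_class phi) =
      [ffun x : {x : G | x \in X} => GH_class (hat phi (val x))].
  by move=> Zphi; split=> [x|]; [apply: hat_cocycle | apply: FE].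
have F'Z (psi : forall x : {x : G | x \in X}, cochain (Cent (val x)) k^o n) :
    (forall x, psi x \in GH_cocycles k (Cent (val x)) n) ->
    unhat gamma psi \in HH_cocycles k G n /\
    F' [ffun x : {x : G | x \in X} => GH_class (psi x)]
      = HH_class (unhat gamma psi).
  move=> Zpsi; split; first exact: unhat_cocycle.
  by rewrite F'E; apply: eq_unhat_class => // x; rewrite coh_reprK ffunE.
split=> // [u|w].
  have Zu := coh_repr_cocycle u; rewrite -(coh_reprK u).
  have [Zhat ->] := FZ _ Zu; have [Zunhat ->] := F'Z _ Zhat.
  (* This composite is the identity only up to a coboundary, unlike the other one, which is already
     the identity on cochains. *)
  apply/esym/coh_classP=> //; apply: hat_homotopy => //.
  by apply/eqP; rewrite -memv_ker.
have [Zr Er] := F'Z _ (r_cocycle n w).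
have -> : w = [ffun x : {x : G | x \in X} => GH_class (r n w x)].
  by apply/ffunP=> x; rewrite ffunE coh_reprK.
rewrite Er; have [_ ->] := FZ _ Zr; apply/ffunP=> x; rewrite !ffunE.
by rewrite hat_unhat.
Qed.
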